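(* Let $V$ be a finite-dimensional real vector space with an inner product, $X$ a metric space, and $\sigma\colon V\to X$ a submetry. Let $S\subset X$ be a closed subset, and denote by $\delta_S$ the distance function to $S$. Then $\sigma^{-1}(S)$ is a convex subset of $V$ if and only if the map $\delta_S\colon\overline{X\setminus S}\to[0,\infty)$ is a submetry.
   Context: A submetry is a map $\sigma\colon Y\to X$ between metric spaces that maps closed balls to closed balls of the same radius, i.e. the image of the closed ball of radius $r$ around $y$ is the closed ball of radius $r$ around $\sigma(y)$. The vector space $V$ carries the Euclidean metric associated with its inner product. The distance function to $S$ is $\delta_S(x)=\inf_{s\in S}d(x,s)$. The closure $\overline{X\setminus S}$ is taken in $X$, and subsets of metric spaces (including $[0,\infty)\subset\mathbb{R}$) carry the restricted metric. *)

(* Defs.v *)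
From HB Require Import structures.
From mathcomp Require Import all_boot all_order all_algebra sesquilinear.
From mathcomp Require Import all_classical all_reals all_analysis.
From mathcomp Require Import ring.

Set Implicit Arguments.
Unset Strict Implicit.
Unset Printing Implicit Defensive.

Import Order.TTheory GRing.Theory Num.Theory.

Local Open Scope classical_set_scope.
Local Open Scope ring_scope.

(* {dot V for idfun} is the type of symmetric positive definite bilinear forms;
   euclidean dot is V with the metric associated with dot. The alias
   is convertible to V but does not carry its linear structure. *)
Definition euclidean (R : realType) (V : vectType R) (dot : {dot V for idfun}) :
  Type := V.

Section euclidean_metric.
Context (R : realType) (V : vectType R) (dot : {dot V for idfun}).
Implicit Types u v w : V.

Let ip u v : R := dot u v.

Definition euclidean_dist (u v : V) : R := Num.sqrt (dot (u - v) (u - v)).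

Let ipC u v : ip u v = ip v u.
Proof. by rewrite /ip (hermC dot) expr0 mul1r. Qed.

Let ip_ge0 u : 0 <= ip u u.
Proof.
have [->|u0] := eqVneq u 0; first by rewrite /ip linear0l.
by rewrite ltW// /ip neq0_dnorm_gt0.
Qed.

Let ip_eq0 u : ip u u = 0 -> u = 0.
Proof.
by move=> uu0; apply: contra_eq uu0 => u0; rewrite gt_eqF// neq0_dnorm_gt0.
Qed.

Let ipZl (a : R) u v : ip (a *: u) v = a * ip u v.
Proof. by rewrite /ip linearZl_LR. Qed.

Let ipZr (a : R) u v : ip u (a *: v) = a * ip u v.
Proof. by rewrite ipC ipZl ipC. Qed.

Let ipDD u v : ip (u + v) (u + v) = ip u u + 2 * ip u v + ip v v.
Proof.
by rewrite /ip linearDl/= !linearDr/= -!/(ip _ _) (ipC v u) mulr2n mulrDl mul1r !addrA.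
Qed.

Let ip_CS u v : ip u v <= Num.sqrt (ip u u) * Num.sqrt (ip v v).
Proof.
have [->|u0] := eqVneq u 0; first by rewrite /ip !linear0l mulr_ge0 ?sqrtr_ge0.
have [->|v0] := eqVneq v 0; first by rewrite /ip !linear0r mulr_ge0 ?sqrtr_ge0.
set a := Num.sqrt (ip u u); set b := Num.sqrt (ip v v).
have a0 : 0 < a by rewrite sqrtr_gt0 /ip neq0_dnorm_gt0.
have b0 : 0 < b by rewrite sqrtr_gt0 /ip neq0_dnorm_gt0.
have aa : ip u u = a ^+ 2 by rewrite sqr_sqrtr.
have bb : ip v v = b ^+ 2 by rewrite sqr_sqrtr.
have := ip_ge0 (b *: u - a *: v).
rewrite ipDD -scaleNr !ipZl !ipZr aa bb.
have -> : b * (b * a ^+ 2) + 2 * (b * (- a * ip u v)) + - a * (- a * b ^+ 2) =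
  2 * (a * b) * (a * b - ip u v) by ring.
by rewrite pmulr_rge0 ?subr_ge0// !mulr_gt0.
Qed.

Let distxx u : euclidean_dist u u = 0.
Proof. by rewrite /euclidean_dist subrr linear0l sqrtr0. Qed.

Let dist_positivity u v : euclidean_dist u v = 0 -> u = v.
Proof.
move/eqP; rewrite sqrtr_eq0 => uv; apply/eqP; rewrite -subr_eq0; apply/eqP.
by apply: ip_eq0; apply/le_anti; rewrite ip_ge0 andbT.
Qed.

Let dist_sym u v : euclidean_dist u v = euclidean_dist v u.
Proof.
by rewrite /euclidean_dist -opprB linearNl/= linearNr/= opprK.
Qed.

Let dist_triangle v u w :
  euclidean_dist u w <= euclidean_dist u v + euclidean_dist v w.
Proof.
rewrite /euclidean_dist -(subrKA v) -!/(ip _ _).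
move: (u - v) (v - w) => x y.
rewrite -(@ler_pXn2r _ 2) ?nnegrE ?addr_ge0 ?sqrtr_ge0//.
rewrite sqrrD !sqr_sqrtr ?ip_ge0// ipDD.
by rewrite lerD2r lerD2l mulr_natl lerMn2r ip_CS.
Qed.

HB.instance Definition _ := Choice.copy (euclidean dot) V.
HB.instance Definition _ := @isMetric.Build R (euclidean dot) euclidean_dist
  distxx dist_positivity dist_sym dist_triangle.

End euclidean_metric.

Section restricted_metric.
Context (R : realType) (X : metricType R) (A : set X).

Let dist (x y : A) : R := mdist (set_val x) (set_val y).

Let dist_ge0 (x y : A) : 0 <= dist x y.
Proof. exact: mdist_ge0. Qed.

Let dist_positivity (x y : A) : dist x y = 0 -> x = y.
Proof. by move=> /mdist_positivity; rewrite set_valE => /val_inj. Qed.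

Let ballEdist (x : A) (d : R) : ball x d = [set y | dist x y < d].
Proof. by rewrite /ball/= /initial_ball ballEmdist. Qed.

HB.instance Definition _ := @PseudoMetric_isMetric.Build R (set_type A)
  dist dist_ge0 dist_positivity ballEdist.

End restricted_metric.

(* Not closed_ball, which is the closure of the open ball: in a general metric
   space it may be smaller. *)
Definition cball (R : realType) (X : metricType R) (x : X) (r : R) : set X :=
  [set y | mdist x y <= r].

Definition submetry (R : realType) (Y X : metricType R) (f : Y -> X) : Prop :=
  forall (y : Y) (r : R), 0 <= r -> f @` cball y r = cball (f y) r.

(* The infimum is taken in R, so it is the distance to S only if S is
   nonempty. *)
Definition dist_fun (R : realType) (X : metricType R) (S : set X) (x : X) : R :=
  inf [set mdist x s | s in S].

Lemma dist_fun_ge0 (R : realType) (X : metricType R) (S : set X) (x : X) :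
  0 <= dist_fun S x.
Proof.
rewrite /dist_fun; have [->|/set0P[s Ss]] := eqVneq S set0.
  by rewrite image_set0 inf0.
apply: lb_le_inf; first by exists (mdist x s), s.
by move=> _ [t _ <-]; exact: mdist_ge0.
Qed.

Definition half_line (R : realType) : set R^o := [set t | 0 <= t].
Arguments half_line R : clear implicits.

Definition dist_fun_closure (R : realType) (X : metricType R) (S : set X)
    (x : closure (~` S)) : half_line R :=
  SigSub (mem_set (dist_fun_ge0 S (set_val x)) : dist_fun S (set_val x) \in half_line R).

(* Main.v *)
Require Import Defs.
From HB Require Import structures.
From mathcomp Require Import all_boot all_order all_algebra sesquilinear.
From mathcomp Require Import all_classical all_reals all_analysis.
From mathcomp Require Import ring lra.

Set Implicit Arguments.
Unset Strict Implicit.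
Unset Printing Implicit Defensive.

Import Order.TTheory GRing.Theory Num.Theory.
Import numFieldNormedType.Exports.

Local Open Scope classical_set_scope.
Local Open Scope ring_scope.

(** Write C for the preimage of S. A submetry is the same as a 1-Lipschitz map
    along which every point [x] of the target lifts to a point at distance at
    most the distance from [f y] to [x], for any prescribed [y]
    ([submetryP]). For the distance function of S, which is always
    1-Lipschitz, only the lifting property [dist_liftable S] remains: from any
    point [x] of the closure of the complement, each value [t >= 0] is attained
    in that closure within distance [|t - delta_S x|] of [x]. Since distances
    to C are distances to S read through sigma, and closures of complements
    correspond, this property holds for S in X iff it holds for C in V
    ([dist_liftable_preimage]). So the question is purely Euclidean.

    Let [d] be the distance to C. If C is convex, smaller values of [d] are
    reached by walking from [y] towards an almost nearest point of C
    ([dist_fun_inward]). For larger values, push [y] away from an almost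
    nearest point [q] of C: the homothety of centre [q] and ratio [mu >= 1]
    multiplies [d] at least by [mu], because the inverse homothety maps C into
    itself ([dist_fun_dilation]). Hence [d] grows at almost unit speed along
    that ray. Both walks give the required value only up to any positive error;
    compactness of closed balls of V gives the exact value
    ([lipschitz_max_cball]). The same compactness covers the boundary points
    of C, where there is no direction to follow: they are limits of points
    outside C ([dist_fun_outward]).

    Conversely, let [x] and [y] be in C and let [z], a point of the segment
    between them, be outside C. Liftability gives, for each [r >= 0], a point
    [w] with [d w = d z + r] at distance at most [r] from [z]. Stewart's
    identity ([stewart]) for the cevian [w z] of the triangle [w x y] then
    bounds [(d z + r)^2 - r^2] by a constant independent of [r], which is
    absurd for large [r] since [d z > 0] ([dist_liftable_convex]). *)

(** * Submetries and distance functions in metric spaces *)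

Section metric.
Context (R : realType).
Implicit Types X Y : metricType R.

Lemma closure_mdistP X (A : set X) (x : X) :
  closure A x <-> forall e, 0 < e -> exists2 a, A a & mdist x a < e.
Proof.
split=> [clA e e0|Ae B].
  have /clA[a [Aa]] : nbhs x (ball x e) by exact: nbhsx_ballx.
  by rewrite ballEmdist; exists a.
rewrite -nbhs_ballE => -[e /= e0 xB]; have [a Aa xa] := Ae e e0.
by exists a; split=> //; apply: xB; rewrite ballEmdist.
Qed.

Lemma closed_cball X (x : X) r : closed (cball x r).
Proof.
move=> y /closure_mdistP cly; rewrite /cball/=; apply/ler_addgt0Pr => e e0.
have [y' xy' yy'] := cly e e0.
rewrite (le_trans (metric_triangle _ y' _))// lerD//.
by rewrite metric_sym ltW.
Qed.

Lemma lipschitz1_continuous X (f : X -> R) :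
  (forall x x', f x <= f x' + mdist x x') -> continuous f.
Proof.
move=> lipf x; apply/cvgrPdist_lt => e e0.
apply: filterS (nbhsx_ballx x _ e0) => x'; rewrite ballEmdist => /= xx'.
have := lipf x x'; have := lipf x' x; rewrite (metric_sym x' x) => xx1 xx2.
by rewrite ltr_norml; lra.
Qed.

(** The inclusion of the image of a ball in the ball is the Lipschitz bound;
    the reverse inclusion is the lifting of points. Taking the ball of radius
    exactly [mdist (f y) x] makes the lift optimal. *)
Lemma submetryP Y X (f : Y -> X) :
  submetry f <->
  (forall y y', mdist (f y) (f y') <= mdist y y') /\
  (forall y x, exists2 y', mdist y y' <= mdist (f y) x & f y' = x).
Proof.
split=> [sf|[lipf liftf] y r r0].
  split=> [y y'|y x].
    have : (f @` cball y (mdist y y')) (f y') by exists y'; rewrite /cball/=.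
    by rewrite sf ?mdist_ge0.
  have : cball (f y) (mdist (f y) x) x by rewrite /cball/=.
  by rewrite -sf ?mdist_ge0// => -[y' yy' <-]; exists y'.
apply/seteqP; split=> [_ [y' yy' <-]|x fyx].
  exact: le_trans (lipf _ _) yy'.
by have [y' yy' <-] := liftf y x; exists y' => //; exact: le_trans yy' fyx.
Qed.

Section dist_fun.
Context X (S : set X).
Implicit Types x s : X.

Lemma dist_fun_le x s : S s -> dist_fun S x <= mdist x s.
Proof.
move=> Ss; apply: ge_inf; last by exists s.
by exists 0 => _ [s' _ <-]; exact: mdist_ge0.
Qed.

Lemma dist_fun0 s : S s -> dist_fun S s = 0.
Proof.
move=> Ss; apply/eqP; rewrite eq_le dist_fun_ge0 andbT.
by rewrite -(mdistxx s) dist_fun_le.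
Qed.

Lemma le_dist_fun a x : S !=set0 ->
  (forall s, S s -> a <= mdist x s) -> a <= dist_fun S x.
Proof.
move=> [s Ss] aS; apply: lb_le_inf; first by exists (mdist x s), s.
by move=> _ [s' Ss' <-]; exact: aS.
Qed.

Lemma dist_fun_approx x e : S !=set0 -> 0 < e ->
  exists2 s, S s & mdist x s < dist_fun S x + e.
Proof.
move=> [s Ss] e0; have hi : has_inf [set mdist x s | s in S].
  split; first by exists (mdist x s), s.
  by exists 0 => _ [s' _ <-]; exact: mdist_ge0.
by have [_ [s' Ss' <-] lt_s'] := inf_adherent e0 hi; exists s'.
Qed.

Lemma dist_fun_lip x x' : S !=set0 ->
  dist_fun S x <= dist_fun S x' + mdist x x'.
Proof.
move=> S0; rewrite -lerBlDr; apply: le_dist_fun => // s Ss.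
rewrite lerBlDr (le_trans (dist_fun_le x Ss))// addrC.
exact: metric_triangle.
Qed.

Lemma dist_fun_gt0 x : S !=set0 -> closed S -> ~ S x -> 0 < dist_fun S x.
Proof.
move=> S0 cS Sx; rewrite lt_neqAle dist_fun_ge0 andbT eq_sym.
apply/eqP => dx0; apply/Sx/cS/closure_mdistP => e e0.
by have [s Ss] := dist_fun_approx x S0 e0; rewrite dx0 add0r; exists s.
Qed.

(** The lifting half of [submetryP] for the distance function of [S] on the
    closure of the complement of [S], written in the ambient space so that it
    can be moved along maps. *)
Definition dist_liftable := forall x t, closure (~` S) x -> 0 <= t ->
  exists x', [/\ closure (~` S) x', mdist x x' <= `|t - dist_fun S x| &
    dist_fun S x' = t].

Lemma submetry_dist_funP : S !=set0 ->
  submetry (@dist_fun_closure R X S) <-> dist_liftable.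
Proof.
move=> S0; split=> [/submetryP[_ lft] x t clx t0|lft].
  have tH : t \in half_line R by rewrite inE.
  have [x' xx' x't] :=
    lft (SigSub (mem_set clx)) (SigSub tH : set_type (half_line R)).
  exists (set_val x'); split; first exact: set_valP.
    exact: xx'.
  exact: (congr1 set_val x't).
apply/submetryP; split=> [x x'|x t].
  have := dist_fun_lip (set_val x) (set_val x') S0.
  have := dist_fun_lip (set_val x') (set_val x) S0.
  rewrite [mdist (set_val x') _]metric_sym => lip' lip.
  change (`|dist_fun S (set_val x') - dist_fun S (set_val x)| <=
    mdist (set_val x) (set_val x')).
  by rewrite ler_norml; lra.
have t0 : 0 <= set_val t by exact: (set_valP t).
have [x' [clx' xx' x't]] := lft _ _ (set_valP x) t0.
exists (SigSub (mem_set clx')); first exact: xx'.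
by apply/val_inj; exact: x't.
Qed.

End dist_fun.

(** The inclusion from right to left is continuity; the other one holds because
    a submetry is open. *)
Lemma preimage_closure Y X (f : Y -> X) (A : set X) : submetry f ->
  f @^-1` closure A = closure (f @^-1` A).
Proof.
move=> /submetryP[lipf liftf]; apply/seteqP.
split=> y /closure_mdistP cly; apply/closure_mdistP => e e0.
  have [x Ax fyx] := cly e e0; have [y' yy' fy'] := liftf y x.
  by exists y'; [rewrite /preimage/= fy'|exact: le_lt_trans yy' fyx].
by have [y' Ay' yy'] := cly e e0; exists (f y') => //; exact: le_lt_trans yy'.
Qed.

Lemma dist_fun_preimage Y X (f : Y -> X) (S : set X) (y : Y) : submetry f ->
  S !=set0 -> dist_fun (f @^-1` S) y = dist_fun S (f y).
Proof.
move=> /submetryP[lipf liftf] S0; have [s Ss] := S0.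
have [y0 _ fy0] := liftf y s.
apply/eqP; rewrite eq_le; apply/andP; split; apply: le_dist_fun => //.
- move=> x Sx; have [y' yy' fy'] := liftf y x.
  by rewrite (le_trans _ yy')// dist_fun_le//= fy'.
- by exists y0; rewrite /= fy0.
- by move=> y' Sy'; rewrite (le_trans _ (lipf _ _))// dist_fun_le.
Qed.

(** Lifts of points near [x] are equally near to a given lift of [x], and
    distances to [S] are read off upstairs. The point [y0] makes [f]
    surjective. *)
Lemma dist_liftable_preimage Y X (f : Y -> X) (S : set X) (y0 : Y) :
  submetry f -> S !=set0 -> dist_liftable (f @^-1` S) <-> dist_liftable S.
Proof.
move=> sf S0; have /submetryP[lipf liftf] := sf.
have clE : closure (~` (f @^-1` S)) = f @^-1` closure (~` S).
  by rewrite preimage_closure.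
have dE y : dist_fun (f @^-1` S) y = dist_fun S (f y).
  exact: dist_fun_preimage.
rewrite /dist_liftable clE; split=> [lft x t clx t0|lft y t clfy t0].
  have [y _ fy] := liftf y0 x.
  have [|y' [cly' yy' y't]] := lft y t _ t0; first by rewrite /= fy.
  rewrite !dE fy in yy' y't.
  by exists (f y'); split=> //; rewrite -{1}fy; exact: le_trans yy'.
have [x [clx fyx xt]] := lft (f y) t clfy t0.
have [y' yy' fy'] := liftf y x; exists y'.
by rewrite !dE /= fy'; split=> //; exact: le_trans yy' fyx.
Qed.

End metric.

(** * Geometry of the Euclidean metric *)

Section euclidean.
Context (R : realType) (V : vectType R) (dot : {dot V for idfun}).
Implicit Types u v w : V.
Local Notation E := (euclidean dot).

Local Notation dist u v := (mdist (u : E) (v : E)).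

Lemma dotC u v : dot u v = dot v u.
Proof. by rewrite (hermC dot) expr0 mul1r. Qed.

Lemma dotDl u v w : dot (u + v) w = dot u w + dot v w.
Proof. by rewrite linearDl. Qed.

Lemma dotZl a u v : dot (a *: u) v = a * dot u v.
Proof. by rewrite linearZl_LR. Qed.

Lemma dotDr u v w : dot u (v + w) = dot u v + dot u w.
Proof. by rewrite linearDr. Qed.

Lemma dotZr a u v : dot u (a *: v) = a * dot u v.
Proof. by rewrite dotC dotZl dotC. Qed.

Lemma dot_ge0 u : 0 <= dot u u.
Proof.
have [->|u0] := eqVneq u 0; first by rewrite linear0l.
by rewrite ltW// neq0_dnorm_gt0.
Qed.

Lemma sqr_dist u v : dist u v ^+ 2 = dot (u - v) (u - v).
Proof. by rewrite sqr_sqrtr// dot_ge0. Qed.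

(** Phrased through difference vectors so that one lemma covers translations
    ([a = 1]), central symmetries and homotheties. *)
Lemma distZ a u v u' v' : u' - v' = a *: (u - v) ->
  dist u' v' = `|a| * dist u v.
Proof.
move=> uv; apply/(@pexpIrn _ 2); rewrite ?nnegrE ?mulr_ge0 ?mdist_ge0//.
by rewrite exprMn !sqr_dist uv dotZl dotZr real_normK ?num_real// mulrA expr2.
Qed.

(** Stewart's theorem for the triangle [w u v] and the point dividing the side
    [u v] in the ratio given by [a]. *)
Lemma stewart a u v w :
  a * dist w u ^+ 2 + (1 - a) * dist w v ^+ 2 =
  dist w (a *: u + (1 - a) *: v) ^+ 2 + a * (1 - a) * dist u v ^+ 2.
Proof.
rewrite !sqr_dist.
have -> : w - (a *: u + (1 - a) *: v) = a *: (w - u) + (1 - a) *: (w - v).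
  rewrite !scalerBr opprD addrACA; congr (_ + _).
  by rewrite -scalerDl addrC subrK scale1r.
have -> : u - v = (w - v) + (-1) *: (w - u).
  by rewrite scaleN1r opprB [RHS]addrC subrKA.
move: (w - u) (w - v) => x y.
rewrite !(dotDl, dotDr, dotZl, dotZr) (dotC y x); ring.
Qed.

(** Cauchy-Schwarz, obtained by squaring the triangle inequality between [u],
    [0] and [-w]. *)
Lemma dot_le_dist u v : `|dot u v| <= dist u 0 * dist v 0.
Proof.
have CS w : dot u w <= dist u 0 * dist w 0.
  have : dist u (- w) <= dist u 0 + dist 0 (- w) by exact: metric_triangle.
  rewrite (@distZ 1 w 0 0 (- w)) ?opprK ?subr0 ?add0r ?scale1r//.
  rewrite normr1 mul1r -(@ler_pXn2r _ 2) ?nnegrE ?addr_ge0 ?mdist_ge0//.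
  rewrite sqrrD !sqr_dist !subr0 opprK !(dotDl, dotDr) (dotC w u).
  lra.
rewrite ler_norml CS andbT lerNl.
have := CS (- v); rewrite linearNr/= => /le_trans; apply.
by rewrite (@distZ (-1) v 0 (- v) 0) ?subr0 ?scaleN1r// normrN1 mul1r.
Qed.

(** * Compactness of closed balls *)

Lemma dist_sum (I : finType) (F : I -> V) :
  dist (\sum_i F i) 0 <= \sum_i dist (F i) 0.
Proof.
elim/big_ind2 : _ => [|a u b v ua vb|//]; first by rewrite mdistxx.
apply: (le_trans (@metric_triangle _ E _ u _)); rewrite addrC lerD//.
rewrite (@distZ 1 v 0 (u + v)) ?normr1 ?mul1r//.
by rewrite scale1r subr0 addrAC subrr add0r.
Qed.

(** On coordinates, the map is Lipschitz with constant the sum [L] of the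
    lengths of the images of the standard basis vectors. *)
Lemma continuous_parametrization n (psi : {linear 'rV[R]_n -> V}) (v : V) :
  continuous (fun x : 'rV[R]_n => v + psi x : E).
Proof.
move=> x.
apply/(@metricType_numDomainType.cvgrPdist_lt _ E _ _ (nbhs_filter x)) => e e0.
pose L := \sum_(j < n) dist (psi (delta_mx 0 j)) 0.
have L0 : 0 <= L by apply: sumr_ge0 => j _; exact: mdist_ge0.
(* [L] may vanish, whence [L + 1]. *)
have d0 : 0 < e / (L + 1) by rewrite divr_gt0// ltr_wpDl.
apply: filterS (nbhsx_ballx x _ d0) => x' [_ xx'].
change (dist (v + psi x) (v + psi x') < e).
rewrite (@distZ 1 (psi (x - x')) 0) ?normr1 ?mul1r; last first.
  by rewrite scale1r subr0 opprD addrACA subrr add0r linearB.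
rewrite [x - x']row_sum_delta linear_sum/=.
apply: (le_lt_trans (dist_sum _)).
apply: (@le_lt_trans _ _ (e / (L + 1) * L)); last first.
  by rewrite mulrAC ltr_pdivrMr ?ltr_wpDl// ltr_pM2l// ltrDl.
rewrite mulr_sumr ler_sum// => j _.
rewrite (@distZ ((x - x') 0 j) (psi (delta_mx 0 j)) 0) ?subr0 ?linearZ//.
by rewrite ler_wpM2r ?mdist_ge0// !mxE ltW//; exact: xx'.
Qed.

(** Send [u] to its inner products with a basis: this linear map [phi] is
    injective by positivity, and bounded on balls by Cauchy-Schwarz. Its linear
    left inverse [psi] is continuous, so that the ball lies in the continuous
    image of a compact box. This avoids both orthonormal bases and the
    equivalence of norms. *)
Lemma compact_cball (v : E) r : compact (cball v r).
Proof.
pose b := vbasis {:V}.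
pose f (u : V) : 'rV[R]_(\dim {:V}) := \row_j dot u (b`_j).
have f_lin : linear f.
  by move=> a u w; apply/rowP => j; rewrite !mxE dotDl dotZl.
pose F : {linear V -> 'rV[R]_(\dim {:V})} :=
  HB.pack f (GRing.isLinear.Build R V _ *:%R f f_lin).
pose phi := linfun F.
have phiE u j : phi u 0 j = dot u (b`_j) by rewrite lfunE/= mxE.
have ker0 : lker phi == 0%VS.
  (* [u - w] is orthogonal to the basis, hence to itself. *)
  apply/lker0P => u w uw; apply/eqP; rewrite -subr_eq0.
  have zb j : dot (u - w) (b`_j) = 0.
    have [jn|nj] := ltnP j (\dim {:V}); last first.
      by rewrite nth_default ?linear0r// size_tuple.
    by rewrite -(phiE _ (Ordinal jn)) linearB/= uw subrr mxE.
  have zz : dot (u - w) (u - w) = 0.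
    rewrite {2}(coord_vbasis (memvf (u - w))) linear_sumr/=.
    by rewrite big1// => j _; rewrite dotZr zb mulr0.
  by apply: contra_eqT zz => z0; rewrite gt_eqF// neq0_dnorm_gt0.
pose psi := (phi^-1)%VF.
have phiK : cancel phi psi by exact: lker0_lfunK.
pose K : set 'rV[R]_(\dim {:V}) :=
  [set x : 'rV[R]_(\dim {:V}) | forall j : 'I_(\dim {:V}),
    `[- (r * dist b`_j 0), r * dist b`_j 0]%classic (x 0 j)].
have cK : compact K.
  apply: (@rV_compact _ _ (fun j : 'I_(\dim {:V}) =>
    `[- (r * dist b`_j 0), r * dist b`_j 0]%classic)) => j.
  exact: segment_compact.
have := @continuous_compact _ _
  (fun x : 'rV[R]_(\dim {:V}) => v + psi x : E) K.
move=> /(_ _ cK) cpsiK.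
apply: (subclosed_compact (@closed_cball R E v r) (cpsiK _)).
  by apply: continuous_subspaceT; exact: continuous_parametrization.
move=> u vu; exists (phi (u - v)); last first.
  by rewrite phiK addrC subrK.
move=> j /=; rewrite phiE in_itv/= -ler_norml.
apply: (le_trans (dot_le_dist _ _)); rewrite ler_wpM2r ?mdist_ge0//.
rewrite (@distZ (-1) v u (u - v) 0) ?normrN1 ?mul1r//.
by rewrite subr0 scaleN1r opprB.
Qed.

Lemma lipschitz_max_cball (f : E -> R) (v : E) (r : R) : 0 <= r ->
  (forall u w : E, f u <= f w + mdist u w) ->
  exists2 w : E, mdist v w <= r & forall u : E, mdist v u <= r -> f u <= f w.
Proof.
move=> r0 lipf.
have cf := lipschitz1_continuous lipf.
have [||w] := @compact_EVT_max _ _ f (cball v r) _ (@compact_cball v r).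
- by exists v; rewrite /cball/= mdistxx.
- exact: continuous_subspaceT.
rewrite inE => vw wmax; exists w => // u vu.
by apply: wmax; rewrite inE.
Qed.

(** * The distance to a subset of Euclidean space *)

Context (C : set E) (C0 : C !=set0).
Local Notation d := (dist_fun C).

(** The homothety of centre [q] and ratio [mu^-1] maps [C] into itself by
    convexity, sends [q + mu *: (y - q)] to [y] and divides distances by
    [mu]. *)
Lemma dist_fun_dilation (q y : V) mu :
  convex_set (C : set (convex_lmodType V)) -> C q -> 1 <= mu ->
  mu * d y <= d (q + mu *: (y - q) : V).
Proof.
move=> cvxC Cq mu1; have mu0 : 0 < mu by exact: lt_le_trans mu1.
apply: le_dist_fun => // c Cc.
have tP : (0 <= mu^-1 <= 1)%R by rewrite invr_ge0 ltW//= invf_le1.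
pose t : {i01 R} := Itv01 (proj1 (andP tP)) (proj2 (andP tP)).
have := cvxC c q t (mem_set Cc) (mem_set Cq); rewrite inE.
(* [p] is the image of [c] under the inverse homothety. *)
set p := (X in C X) => Cp.
have pE : p = mu^-1 *: (c : V) + (1 - mu^-1) *: q by [].
change (mu * d y <= dist (q + mu *: (y - q)) c).
rewrite (@distZ mu y p) ?gtr0_norm ?ler_pM2l ?dist_fun_le//.
have mup : mu *: p = (c : V) + (mu *: q - q).
  rewrite pE scalerDr !scalerA mulrBr mulfV ?gt_eqF// mulr1 scale1r.
  by rewrite scalerBl scale1r.
rewrite (scalerBr mu y p) mup scalerBr opprD opprB.
by rewrite [LHS]addrC [RHS]addrCA; congr (_ + _); rewrite addrCA.
Qed.

(** Move [y] by [r] away from an almost nearest point [q] of [C]. By dilation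
    the distance to [C] grows by at least [r * d y / dist y q], which tends to
    [r] as [dist y q] tends to [d y]. *)
Lemma dist_fun_outward_approx (y : V) r e :
  convex_set (C : set (convex_lmodType V)) -> 0 < d y -> 0 <= r -> 0 < e ->
  exists2 w, dist y w <= r & d y + r <= d w + e.
Proof.
move=> cvxC dy0 r0 e0.
(* The tolerance makes the loss [r * (dist y q - d y) / dist y q] at most [e];
   [r + 1] keeps it meaningful when [r = 0]. *)
have [||q Cq yq] := @dist_fun_approx _ _ C y (e * d y / (r + 1)) => //.
  by rewrite divr_gt0 ?mulr_gt0// ltr_wpDl.
have le_dm : d y <= dist y q by exact: dist_fun_le.
have m0 : 0 < dist y q by exact: lt_le_trans dy0 _.
pose mu := 1 + r / dist y q.
have mu1 : 1 <= mu by rewrite lerDl divr_ge0// ltW.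
exists (q + mu *: (y - q)).
  rewrite (@distZ (mu - 1) q y); last first.
    by rewrite opprD addrA -scalerN opprB scalerBl scale1r opprB addrC.
  rewrite ger0_norm ?subr_ge0// /mu addrC addKr.
  rewrite [dist q y]metric_sym divfK// gt_eqF//.
have := dist_fun_dilation y cvxC Cq mu1.
have -> : mu * d y = d y + r * d y / dist y q.
  by rewrite /mu mulrDl mul1r mulrAC.
suff : r <= r * d y / dist y q + e by lra.
rewrite -(ler_pM2r m0) mulrDl divfK ?gt_eqF//.
have le_m := ltW yq.
have : r * (e * d y / (r + 1)) <= e * d y.
  rewrite mulrA ler_pdivrMr ?ltr_wpDl//.
  by have := mulr_gt0 e0 dy0; nra.
nra.
Qed.

(** The maximum [w] of [d] on the closed ball works. When [y] is on the boundary
    of [C] there is no nearest point to move away from, so start instead at a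
    point [y'] outside [C] close to [y]. Finite dimension is essential here: it
    stands in for a supporting hyperplane at [y]. *)
Lemma dist_fun_outward (y : V) r :
  convex_set (C : set (convex_lmodType V)) -> closed C ->
  closure (~` C) (y : E) -> 0 <= r ->
  exists2 w, dist y w <= r & d w = d y + r.
Proof.
move=> cvxC clC cly; rewrite le_eqVlt => /predU1P[<-|r0].
  by exists y; rewrite ?addr0// mdistxx.
have [w yw wmax] := lipschitz_max_cball (y : E) (ltW r0)
  (fun x x' => dist_fun_lip x x' C0).
exists w => //; apply/eqP; rewrite eq_le; apply/andP; split.
  have := dist_fun_lip w (y : E) C0; rewrite (metric_sym w) => /le_trans; apply.
  by rewrite lerD2l.
apply/ler_addgt0Pr => e e0.
(* Going from [y] to [y'] costs [h] in the radius and [h] in [d], and the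
   approximation costs another [h]. *)
pose h := Num.min r (e / 3).
have h0 : 0 < h by rewrite lt_min r0 divr_gt0.
have /closure_mdistP/(_ _ h0)[y' Cy' yy'] := cly.
have h_r : 0 <= r - h by rewrite subr_ge0 ge_min lexx.
have [v y'v dv] :=
  dist_fun_outward_approx cvxC (dist_fun_gt0 C0 clC Cy') h_r h0.
have := dist_fun_lip (y : E) y' C0.
have : d v <= d w.
  apply: wmax; apply: (le_trans (metric_triangle _ y' _)).
  by move: y'v; lra.
have : h <= e / 3 by rewrite ge_min lexx orbT.
lra.
Qed.

Lemma segment_dist (y w : V) s : 0 <= s <= 1 ->
  dist y (y + s *: (w - y)) = s * dist y w /\
  dist (y + s *: (w - y)) w = (1 - s) * dist y w.
Proof.
move=> /andP[s0 s1]; split.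
  rewrite (@distZ s y w) ?ger0_norm//.
  by rewrite opprD addrA subrr add0r -scalerN opprB.
rewrite (@distZ (1 - s) y w) ?ger0_norm ?subr_ge0//.
by rewrite scalerBl scale1r -scalerN opprB addrAC.
Qed.

(** The minimum [w] of [d] on the ball of radius [d y - t] works: the Lipschitz
    bound gives [t <= d w], and walking from [y] towards almost nearest points
    of [C] gives [d w <= t]. *)
Lemma dist_fun_inward (y : V) t : 0 <= t <= d y ->
  exists2 w, dist y w <= d y - t & d w = t.
Proof.
move=> /andP[t0 td]; have dt0 : 0 <= d y - t by rewrite subr_ge0.
have lipNd (u w : E) : - d u <= - d w + mdist u w.
  by have := dist_fun_lip w u C0; rewrite (metric_sym w); lra.
have [w yw wmin] := lipschitz_max_cball (y : E) dt0 lipNd.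
exists w => //; apply/eqP; rewrite eq_le; apply/andP; split; last first.
  by have := dist_fun_lip (y : E) w C0; lra.
apply/ler_addgt0Pr => e e0.
have [q Cq yq] := dist_fun_approx (y : E) C0 e0.
have de0 : 0 < d y + e by rewrite ltr_wpDl ?dist_fun_ge0.
pose s := (d y - t) / (d y + e).
have s01 : 0 <= s <= 1.
  by rewrite divr_ge0 ?(ltW de0)//= ler_pdivrMr// mul1r; lra.
have sde : s * (d y + e) = d y - t by rewrite divfK// gt_eqF.
have [yz zq] := segment_dist y q s01; set z := y + _ in yz zq.
have : - d z <= - d w.
  apply: wmin; change (dist y z <= d y - t).
  by rewrite yz -sde ler_wpM2l ?(ltW yq)//; case/andP: s01.
have : d z <= dist z q by exact: dist_fun_le.
rewrite zq; move: (ltW yq) => ltyq.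
case/andP: s01 => _ s1; nra.
Qed.

(** The points of the segment from [y] to [w] other than [w] are at distance
    less than [d y] from [y], hence outside [C]. This is needed when [w] is a
    nearest point of [C] to [y]. *)
Lemma dist_fun_nearest_closure (y w : V) : 0 < d y -> dist y w <= d y ->
  closure (~` C) (w : E).
Proof.
move=> dy0 yw; apply/closure_mdistP => e e0.
(* The point at parameter [s] is at distance at most [e / 2] from [w]. *)
pose s := Num.max 0 (1 - e / (d y + d y)).
have s0 : 0 <= s by rewrite le_max lexx.
have s1 : s < 1 by rewrite gt_max ltr01 gtrBl divr_gt0// addr_gt0.
have s01 : 0 <= s <= 1 by rewrite s0 ltW.
have se : 1 - s <= e / (d y + d y).
  by rewrite lerBlDr -lerBlDl le_max lexx orbT.
have sde : (1 - s) * d y < e.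
  apply: (@le_lt_trans _ _ (e / (d y + d y) * d y)); last first.
    by rewrite mulrAC ltr_pdivrMr ?addr_gt0// ltr_pM2l// ltrDl.
  by rewrite ler_wpM2r// ltW.
have [yz zw] := segment_dist y w s01; set z := y + _ in yz zw.
exists z.
  move=> Cz; have : d y <= dist y z by exact: dist_fun_le.
  by rewrite yz; nra.
rewrite metric_sym; change (dist z w < e); rewrite zw.
by apply: le_lt_trans sde; rewrite ler_wpM2l// subr_ge0 ltW.
Qed.

Lemma convex_dist_liftable : closed C ->
  convex_set (C : set (convex_lmodType V)) -> dist_liftable C.
Proof.
move=> clC cvxC y t cly t0.
have [dt|td] := leP (d y) t.
  have [|w yw dw] := @dist_fun_outward y (t - d y) cvxC clC cly.
    by rewrite subr_ge0.
  (* If [t = 0] then [w] is in [C], and only [y] is known to be in the closure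
     of the complement. *)
  have [t_0|t_neq0] := eqVneq t 0.
    have dy0 : d y = 0 by apply/eqP; rewrite eq_le dist_fun_ge0 -t_0 dt.
    by exists y; rewrite mdistxx dy0 t_0.
  have dwt : d w = t by rewrite dw addrC subrK.
  exists w; split=> //; last by rewrite ger0_norm ?subr_ge0.
  apply: subset_closure => /(dist_fun0 (S := C)) dw0.
  by move/eqP : t_neq0; apply; rewrite -dwt.
have [|w yw dw] := @dist_fun_inward y t; first by rewrite t0 ltW.
exists w; split=> //.
  apply: (@dist_fun_nearest_closure y); first exact: le_lt_trans td.
  by apply: (le_trans yw); rewrite gerBl.
by rewrite distrC gtr0_norm ?subr_gt0.
Qed.

(** The points [w] run away from [z] at a rate that keeps them far from the two
    ends of the segment. For [z] inside the segment the squared distances to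
    the ends average, up to a constant [K], to the squared distance to [z], so
    [(d z + r)^2 <= r^2 + K] for all [r]. *)
Lemma dist_liftable_convex : closed C ->
  dist_liftable C -> convex_set (C : set (convex_lmodType V)).
Proof.
move=> clC lft x y l.
rewrite !inE => Cx Cy; apply: contrapT => Cz.
set z := (X in C X) in Cz.
have zE : z = l%:num *: (x : V) + (1 - l%:num) *: (y : V) by [].
have d0 : 0 < d z by exact: dist_fun_gt0.
pose K := l%:num * (1 - l%:num) * dist x y ^+ 2.
have l0 : 0 <= l%:num by [].
have l1 : l%:num <= 1 by [].
have K0 : 0 <= K by rewrite mulr_ge0 ?sqr_ge0// mulr_ge0// subr_ge0.
(* With this [r] the inequality [d z ^+ 2 + 2 * d z * r <= K] reads
   [d z ^+ 2 <= 0]. *)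
pose r := K / (2 * d z).
have r0 : 0 <= r by rewrite divr_ge0// mulr_ge0// ltW.
have rK : r * (2 * d z) = K by rewrite divfK// gt_eqF// mulr_gt0.
have [||w [_ zw dw]] := lft z (d z + r).
- exact: subset_closure.
- by rewrite addr_ge0// ltW.
rewrite [X in `|X|]addrAC subrr add0r ger0_norm// in zw.
have := stewart l%:num x y w; rewrite -zE -/K.
have dx : d z + r <= dist w x by rewrite -dw dist_fun_le.
have dy : d z + r <= dist w y by rewrite -dw dist_fun_le.
have wz : dist w z <= r by rewrite metric_sym.
have dx2 : (d z + r) ^+ 2 <= dist w x ^+ 2.
  by rewrite ler_pXn2r ?nnegrE ?mdist_ge0 ?addr_ge0// ltW.
have dy2 : (d z + r) ^+ 2 <= dist w y ^+ 2.
  by rewrite ler_pXn2r ?nnegrE ?mdist_ge0 ?addr_ge0// ltW.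
have wz2 : dist w z ^+ 2 <= r ^+ 2.
  by rewrite ler_pXn2r ?nnegrE ?mdist_ge0.
have : (d z + r) ^+ 2 <=
    l%:num * dist w x ^+ 2 + (1 - l%:num) * dist w y ^+ 2.
  have <- : l%:num * (d z + r) ^+ 2 + (1 - l%:num) * (d z + r) ^+ 2 =
    (d z + r) ^+ 2 by ring.
  by rewrite lerD// ler_wpM2l ?subr_ge0.
have : 0 < d z ^+ 2 by rewrite exprn_gt0.
have -> : (d z + r) ^+ 2 = d z ^+ 2 + r * (2 * d z) + r ^+ 2 by ring.
rewrite rK; lra.
Qed.

End euclidean.

Theorem theorem1 (R : realType) (V : vectType R) (dot : {dot V for idfun})
    (X : metricType R) (sigma : euclidean dot -> X) (S : set X) :
  submetry sigma -> closed S -> S !=set0 ->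
  convex_set (sigma @^-1` S : set (convex_lmodType V)) <->
  submetry (@dist_fun_closure R X S).
Proof.
move=> sigmaP clS S0; have /submetryP[lip lft] := sigmaP.
have y0 : euclidean dot := (0 : V).
have C0 : sigma @^-1` S !=set0.
  have [s Ss] := S0; have [y _ sy] := lft y0 s.
  by exists y; rewrite /preimage/= sy.
have clC : closed (sigma @^-1` S).
  by apply/closure_id; rewrite -preimage_closure// -(proj1 (closure_id S) clS).
have lftE := dist_liftable_preimage y0 sigmaP S0.
apply: (iff_trans _ (iff_sym (submetry_dist_funP S0))).
apply: (iff_trans _ lftE).
split; first exact: convex_dist_liftable.
exact: dist_liftable_convex.
Qed.
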